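(* Let $P\subseteq G$ be the monoid attached to a graph of monoids as described in the context. Suppose that for all $e\in T\amalg A$ and all $p\in P_{o(e)}$, the set $p^{-1}(P_{\bar e}^{\bar e}):=\{x\in P_{o(e)} : px\in P_{\bar e}^{\bar e}\}$ is either empty or of the form $qP_{\bar e}^{\bar e}$ for some $q\in P_{o(e)}$. Then $P$ is right LCM, i.e., for all $p,q\in P$, either $pP\cap qP=\emptyset$ or $pP\cap qP=rP$ for some $r\in P$.
   Context: Setting. $(V,E)$ is a connected graph in the sense of Serre: every edge $e\in E$ has an origin $o(e)\in V$, a target $t(e)\in V$ and an inverse edge $\bar e\neq e$ with $\bar{\bar e}=e$ and $o(\bar e)=t(e)$. A graph of groups on $(V,E)$ is given: groups $G_v$ ($v\in V$), groups $G_e=G_{\bar e}$ ($e\in E$), and injective homomorphisms $G_e\to G_{t(e)},\ x\mapsto x^e$ and $G_e\to G_{o(e)},\ x\mapsto x^{\bar e}$. For $S\subseteq G_e$, $S^e$ and $S^{\bar e}$ denote the images of $S$ under these maps. The identity of a group is denoted $\epsilon$. Fix a decomposition $E=A\amalg\bar A\amalg T$, where $T$ is a maximal subtree (containing with each edge its inverse; $T$ also denotes its set of edges). Let $$G=\langle \{G_v\}_{v\in V}\cup A \mid g^{\bar e}e=eg^e\ \forall g\in G_e, e\in A;\ g^{\bar e}=g^e\ \forall g\in G_e, e\in T\rangle$$ (the fundamental group of the graph of groups; the groups $G_v$ embed into $G$). Each $G_v$ is a totally ordered group with positive cone $P_v$ (a submonoid with $G_v=P_v\cup P_v^{-1}$,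 $P_v\cap P_v^{-1}=\{\epsilon\}$). For $e\in E$ put $P_e:=\{g\in G_e: g^e\in P_{t(e)}\}$ and $P_{\bar e}:=\{g\in G_{\bar e}=G_e: g^{\bar e}\in P_{o(e)}\}$. It is assumed that $P_e=P_{\bar e}$ for all $e\in T$, and that there is a decomposition $A=A_+\amalg A_-$ with $P_{\bar e}^e\subseteq P_{t(e)}$ for all $e\in A_+$ and $P_{\bar e}^e\subseteq P_{t(e)}^{-1}$ for all $e\in A_-$. $P$ is the submonoid of $G$ generated by $\bigcup_{v\in V}P_v\cup A$. *)

(* Defs.v *)
From HB Require Import structures.
From mathcomp Require Import all_boot.
From mathcomp Require Import boolp classical_sets.

Set Implicit Arguments.
Unset Strict Implicit.
Unset Printing Implicit Defensive.

Local Open Scope classical_set_scope.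
Local Open Scope quotient_scope.
Local Open Scope group_scope.

Record serre_graph := SerreGraph {
  vertex : choiceType;
  edge : choiceType;
  orig : edge -> vertex;
  targ : edge -> vertex;
  inv_edge : edge -> edge;
  inv_edgeK : involutive inv_edge;
  inv_edge_neq : forall e, inv_edge e <> e;
  orig_inv_edge : forall e, orig (inv_edge e) = targ e
}.

Arguments orig {s} e : rename.
Arguments targ {s} e : rename.

Section Graph.
Variable X : serre_graph.
Implicit Types (v w : vertex X) (e : edge X) (p : seq (edge X)).
Implicit Types (W : set (vertex X)) (S : set (edge X)).

Fixpoint edge_path v p w : Prop :=
  if p is e :: q then orig e = v /\ edge_path (targ e) q w else v = w.

Definition subgraph W S : Prop :=
  (forall e, S e -> S (inv_edge e)) /\
  (forall e, S e -> W (orig e) /\ W (targ e)).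

Definition connected_subgraph W S : Prop :=
  forall v w, W v -> W w ->
    exists p, edge_path v p w /\ (forall e, e \in p -> S e).

Definition connected_graph : Prop := connected_subgraph setT setT.

(* A subgraph isomorphic to Circ_n for some n >= 1, described by a closed edge
   path. For n >= 3 the absence of backtracking follows from the distinctness
   of the vertices; for n = 2 it excludes the path (e, inv_edge e). *)
Definition circuit S p : Prop :=
  [/\ p <> [::], exists v, edge_path v p v, forall e, e \in p -> S e,
      sorted (fun e f => f != inv_edge e) p & uniq (map (@targ X) p)].

Definition subtree W S : Prop :=
  [/\ subgraph W S, W !=set0, connected_subgraph W S &
      forall p, ~ circuit S p].

Definition maximal_subtree W S : Prop :=
  subtree W S /\
  forall W' S', subtree W' S' -> W `<=` W' -> S `<=` S' -> W' = W /\ S' = S.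

Definition maximal_subtree_edges S : Prop := exists W, maximal_subtree W S.

Definition edge_decomposition (A T : set (edge X)) : Prop :=
  let Abar := [set inv_edge e | e in A] in
  [/\ A `|` Abar `|` T = setT, A `&` Abar = set0, A `&` T = set0 &
      Abar `&` T = set0].

End Graph.

Section Presentation.
Variables (gen : choiceType).

(* The letter (x, false) stands for x and (x, true) for its inverse. *)
Definition word := seq (gen * bool).

Variable R : word -> word -> Prop.

Inductive word_eq : word -> word -> Prop :=
| word_eq_rel u v : R u v -> word_eq u v
| word_eq_cancel x b : word_eq [:: (x, b); (x, ~~ b)] [::]
| word_eq_cat u u' v v' :
    word_eq u u' -> word_eq v v' -> word_eq (u ++ v) (u' ++ v')
| word_eq_refl u : word_eq u u
| word_eq_sym u v : word_eq u v -> word_eq v u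
| word_eq_trans u v w : word_eq u v -> word_eq v w -> word_eq u w.

Definition word_eqb : rel word := fun u v => `[< word_eq u v >].

Lemma word_eqb_equiv : equiv_class_of word_eqb.
Proof.
split=> [u|u v|v u w].
- exact/asboolP/word_eq_refl.
- by apply/asboolP/asboolP; apply: word_eq_sym.
- by move=> /asboolP uv /asboolP vw; apply/asboolP; exact: word_eq_trans uv vw.
Qed.

Canonical word_equiv := EquivRelPack word_eqb_equiv.

Definition presented := {eq_quot word_equiv}.
HB.instance Definition _ := Choice.on presented.
HB.instance Definition _ := Quotient.on presented.

Lemma presented_eqP (u v : word) :
  (\pi_presented u = \pi_presented v) <-> word_eq u v.
Proof. by split=> [/eqquotP/asboolP|uv]; last exact/eqquotP/asboolP. Qed.

Definition word_inv (u : word) : word := [seq (x.1, ~~ x.2) | x <- rev u].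

Lemma word_inv_cat u v : word_inv (u ++ v) = word_inv v ++ word_inv u.
Proof. by rewrite /word_inv rev_cat map_cat. Qed.

Lemma word_invK : involutive word_inv.
Proof.
move=> u; rewrite /word_inv -map_rev revK -map_comp -[RHS]map_id.
by apply: eq_map => -[x b] /=; rewrite negbK.
Qed.

Lemma word_mulV u : word_eq (u ++ word_inv u) [::].
Proof.
elim: u => [|[x b] u IH]; first exact: word_eq_refl.
rewrite -cat1s word_inv_cat -catA [u ++ _]catA.
apply: word_eq_trans (word_eq_cancel x b).
apply: (@word_eq_cat [:: _] [:: _] _ [:: _]); first exact: word_eq_refl.
rewrite -[X in word_eq _ X]cat0s; apply: word_eq_cat => //.
exact: word_eq_refl.
Qed.

Lemma word_eq_inv u v : word_eq u v -> word_eq (word_inv u) (word_inv v).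
Proof.
move=> uv; have uVv : word_eq (word_inv u ++ u) [::].
  by rewrite -{2}[u]word_invK; apply: word_mulV.
apply: (@word_eq_trans _ (word_inv u ++ (v ++ word_inv v))).
  rewrite -{1}[word_inv u]cats0; apply: word_eq_cat; first exact: word_eq_refl.
  exact/word_eq_sym/word_mulV.
rewrite catA -[X in word_eq _ X]cat0s; apply: word_eq_cat.
  apply: word_eq_trans uVv; apply: word_eq_cat; first exact: word_eq_refl.
  exact: word_eq_sym.
exact: word_eq_refl.
Qed.

Definition presented_mul (a b : presented) : presented :=
  \pi_presented (repr a ++ repr b).
Definition presented_inv (a : presented) : presented :=
  \pi_presented (word_inv (repr a)).
Definition presented_one : presented := \pi_presented [::].

Lemma repr_pi_word (u : word) : word_eq (repr (\pi_presented u)) u.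
Proof. by apply/presented_eqP; rewrite reprK. Qed.

Lemma presented_mulE u v :
  presented_mul (\pi_presented u) (\pi_presented v) = \pi_presented (u ++ v).
Proof. by apply/presented_eqP/word_eq_cat; exact: repr_pi_word. Qed.

Lemma presented_invE u :
  presented_inv (\pi_presented u) = \pi_presented (word_inv u).
Proof. by apply/presented_eqP/word_eq_inv/repr_pi_word. Qed.

Lemma presented_pi (a : presented) : exists u, a = \pi_presented u.
Proof. by exists (repr a); rewrite reprK. Qed.

Lemma presented_mulA : associative presented_mul.
Proof.
move=> a b c; have [u ->] := presented_pi a; have [v ->] := presented_pi b.
by have [w ->] := presented_pi c; rewrite !presented_mulE catA.
Qed.

Lemma presented_mul1l : left_id presented_one presented_mul.
Proof. by move=> a; have [u ->] := presented_pi a; rewrite presented_mulE. Qed.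

Lemma presented_mul1r : right_id presented_one presented_mul.
Proof.
by move=> a; have [u ->] := presented_pi a; rewrite presented_mulE cats0.
Qed.

Lemma presented_mulVl : left_inverse presented_one presented_inv presented_mul.
Proof.
move=> a; have [u ->] := presented_pi a; rewrite presented_invE presented_mulE.
by apply/presented_eqP; rewrite -{2}[u]word_invK; apply: word_mulV.
Qed.

Lemma presented_mulVr : right_inverse presented_one presented_inv presented_mul.
Proof.
move=> a; have [u ->] := presented_pi a; rewrite presented_invE presented_mulE.
by apply/presented_eqP; apply: word_mulV.
Qed.

HB.instance Definition _ := isGroup.Build presented presented_mulA
  presented_mul1l presented_mul1r presented_mulVl presented_mulVr.

Definition generator (x : gen) : presented := \pi_presented [:: (x, false)].

End Presentation.

Section Monoids.
Variable G : groupType.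
Implicit Types (P S : set G) (p q r x : G).

Definition submonoid P : Prop :=
  P 1 /\ (forall x y, P x -> P y -> P (x * y)).

Definition invset P : set G := [set x^-1 | x in P].

Definition lmulset p S : set G := [set p * x | x in S].

Definition positive_cone P : Prop :=
  [/\ submonoid P, P `|` invset P = setT & P `&` invset P = [set 1]].

Definition right_LCM P : Prop :=
  forall p q, P p -> P q ->
    lmulset p P `&` lmulset q P = set0 \/
    exists2 r, P r & lmulset p P `&` lmulset q P = lmulset r P.

End Monoids.

(* [emb_targ e x] is x^e and [emb_orig e x] is x^ebar. The identification of
   G_e with G_ebar is the isomorphism [eflip e]; it exchanges the two
   embeddings. As they land in vertex groups at provably but not definitionally
   equal vertices, this is expressed in the disjoint union of these groups. *)
Record graph_of_groups (X : serre_graph) := GraphOfGroups {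
  vgroup : vertex X -> groupType;
  egroup : edge X -> groupType;
  emb_targ : forall e, {multiplicative egroup e -> vgroup (targ e)};
  emb_orig : forall e, {multiplicative egroup e -> vgroup (orig e)};
  emb_targ_inj : forall e, injective (emb_targ e);
  emb_orig_inj : forall e, injective (emb_orig e);
  eflip : forall e, {multiplicative egroup e -> egroup (inv_edge e)};
  eflip_bij : forall e, bijective (eflip e);
  emb_targ_flip : forall e (x : egroup e),
    Tagged vgroup (emb_targ (inv_edge e) (eflip e x)) =
    Tagged vgroup (emb_orig e x);
  emb_orig_flip : forall e (x : egroup e),
    Tagged vgroup (emb_orig (inv_edge e) (eflip e x)) =
    Tagged vgroup (emb_targ e x)
}.

Arguments emb_targ {X} GG e : rename.
Arguments emb_orig {X} GG e : rename.
Arguments eflip {X} GG e : rename.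

Section FundamentalGroup.
Variables (X : serre_graph) (GG : graph_of_groups X) (A T : set (edge X)).

Definition fund_gen : choiceType := ({v : vertex X & vgroup GG v} + A)%type.

Definition vletter v (g : vgroup GG v) : fund_gen * bool :=
  (inl (Tagged (vgroup GG) g), false).
Definition eletter (a : A) : fund_gen * bool := (inr a, false).

Inductive fund_rel : word fund_gen -> word fund_gen -> Prop :=
| fund_rel_vertex v (g h : vgroup GG v) :
    fund_rel [:: vletter g; vletter h] [:: vletter (g * h)]
| fund_rel_edge (a : A) (g : egroup GG (val a)) :
    fund_rel [:: vletter (emb_orig GG _ g); eletter a]
             [:: eletter a; vletter (emb_targ GG _ g)]
| fund_rel_tree e (g : egroup GG e) : T e ->
    fund_rel [:: vletter (emb_orig GG _ g)] [:: vletter (emb_targ GG _ g)].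

Definition fund_group : groupType := presented fund_rel.

Definition of_vertex v (g : vgroup GG v) : fund_group :=
  generator fund_rel (inl (Tagged (vgroup GG) g)).
Definition of_edge (a : A) : fund_group := generator fund_rel (inr a).

Variable P : forall v, set (vgroup GG v).
Arguments P : clear implicits.

Definition graph_monoid : set fund_group :=
  smallest (@submonoid fund_group)
    ((\bigcup_v (@of_vertex v @` P v)) `|` range of_edge).

End FundamentalGroup.

Arguments of_vertex {X} GG A T {v} g.
Arguments of_edge {X} GG {A} T a.
Arguments graph_monoid {X GG} A T P.

Unset Implicit Arguments.

Section EdgeCones.
Variables (X : serre_graph) (GG : graph_of_groups X).
Variable P : forall v, set (vgroup GG v).

(* P_e and P_ebar, both as subsets of G_e = G_ebar. *)
Definition cone_targ e : set (egroup GG e) :=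
  [set g | P (targ e) (emb_targ GG e g)].
Definition cone_orig e : set (egroup GG e) :=
  [set g | P (orig e) (emb_orig GG e g)].

(* P_ebar^ebar *)
Definition cone_orig_image e : set (vgroup GG (orig e)) :=
  emb_orig GG e @` cone_orig e.

(* p^-1 (P_ebar^ebar) *)
Definition cone_quotient e (p : vgroup GG (orig e)) : set (vgroup GG (orig e)) :=
  [set x | P (orig e) x /\ cone_orig_image e (p * x)].

End EdgeCones.

Arguments cone_targ {X GG} P e.
Arguments cone_orig {X GG} P e.
Arguments cone_orig_image {X GG} P e.
Arguments cone_quotient {X GG} P e p.

(* Main.v *)
From HB Require Import structures.
Require Import Defs.
From mathcomp Require Import all_boot.
From mathcomp Require Import boolp classical_sets.

(** Write [g <= h] when [g^-1 * h] lies in the monoid [P]. Principal right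
    ideals of [P] are the up-sets of its elements for this preorder, so the
    claim is that two elements of [P] with a common upper bound have a least
    one.

    The preorder is generated by two kinds of moves: inside a coset [g G_v],
    which is a chain because [G_v] is totally ordered, and across an edge [e] of
    [T] or [A], from [g] to [g e] (with [e = 1] in [G] if [e] is in [T]). Hence
    [g <= h] means that a path in the Bass-Serre tree made of such moves leads
    from [g] to [h]; these are the positive paths [pos_path] below. The only
    feature of the tree that is needed is that removing an edge separates it
    into two halves, so that a path from one half to the other uses that edge.

    Let positive paths lead from [p] and from [q] to a common upper bound [z];
    the least upper bound is found by induction on their total length
    ([bounded_has_lub]). Suppose that the path from [p] first moves to [k] in
    the coset of [p] and then crosses [e]. If [z] lies on the near side of this
    edge, the path comes back across it and can be shortened
    ([half_tree_return]). If [z] is on the far side and [q] on the near side,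
    both paths cross the same edge, so both reach the chain [p G_v] and stop
    there at a smaller upper bound. If [q] and [z] are both on the far side and
    [p], [q] are incomparable, the path from [1] to [p] or to [q] shows that
    some [g <= p] in [P] lies in the coset [k G_e] of the points that can cross
    the edge. The hypothesis on [p^-1 (P_ebar^ebar)] then says that the points
    of [k G_e] above [p] have a least element [h], and [p] can be replaced by
    [h e] without changing the common upper bounds of [p] and [q], for a common
    upper bound on the near side would be reached from [q] through [k G_e] as
    well ([advance]). For [e] in [A_-] this third case is impossible: larger
    elements of [k G_e] go to smaller ones beyond [e], which would force
    [p <= q].

    Separation by edges, and the injectivity of [G_v -> G] by which [P] meets
    [G_v] in [P_v] only, come without normal forms. [G] acts on a set as soon as
    each [G_v] acts and each edge is given a bijection that intertwines the two
    actions of its group, inverse edges of [T] having inverse bijections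
    ([fund_group_rep]). Two such actions are used: one on two copies of the
    product of all [G_v], in which every [G_v] acts faithfully
    ([of_vertex_inj]), and one on [G * bool], whose second coordinate counts
    modulo 2 how often a path crosses a given edge ([half_tree]). *)

Set Implicit Arguments.
Unset Strict Implicit.
Unset Printing Implicit Defensive.

Local Open Scope classical_set_scope.
Local Open Scope quotient_scope.
Local Open Scope group_scope.

(** * Paths and circuits in graphs *)

Lemma not_uniq_map_split (I : Type) (J : eqType) (f : I -> J) (s : seq I) :
  ~~ uniq (map f s) ->
  exists a x b y c, s = a ++ x :: b ++ y :: c /\ f x = f y.
Proof.
have mem_split z t : z \in map f t -> exists b y c, t = b ++ y :: c /\ z = f y.
  elim: t => //= y t IH; rewrite inE => /orP[/eqP zy|].
    by exists [::], y, t.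
  by case/IH=> b [y' [c [-> zy]]]; exists (y :: b), y', c.
elim: s => //= x s IH; rewrite negb_and negbK => /orP[|/IH].
  by case/mem_split=> b [y [c [-> xy]]]; exists [::], x, b, y, c.
by move=> [a [x' [b [y [c [-> xy]]]]]]; exists (x :: a), x', b, y, c.
Qed.

Lemma not_sorted_split (I : Type) (r : rel I) (s : seq I) :
  ~~ sorted r s -> exists a x y b, s = a ++ x :: y :: b /\ ~~ r x y.
Proof.
case: s => // x s /=; elim: s x => //= y s IH x; rewrite negb_and.
case/orP=> [nr|/IH[a [x' [y' [b [-> nr]]]]]]; first by exists [::], x, y, s.
by exists (x :: a), x', y', b.
Qed.

Section Graphs.
Variable X : serre_graph.
Implicit Types (v w : vertex X) (e f : edge X) (p q : seq (edge X)).
Implicit Types (W : set (vertex X)) (S : set (edge X)).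

Lemma targ_inv_edge e : targ (inv_edge e) = orig e.
Proof. by rewrite -orig_inv_edge inv_edgeK. Qed.

Lemma edge_path_cat v w p q :
  edge_path v (p ++ q) w <-> exists2 u, edge_path v p u & edge_path u q w.
Proof.
elim: p v => [|e p IH] v /=; first by split=> [|[u ->]] //; exists v.
split=> [[oe /IH[u pu uq]]|[u [oe pu] uq]]; first by exists u.
by split=> //; apply/IH; exists u.
Qed.

Lemma edge_path_rcons v w p e : edge_path v (rcons p e) w -> targ e = w.
Proof. by rewrite -cats1 => /edge_path_cat[u _ [_ /= ->]]. Qed.

Section CircuitFree.
Variable S : set (edge X).
Hypothesis circuit_free : forall p, ~ circuit S p.

(** A closed path in a graph without circuits contracts to the empty path: it
    backtracks somewhere, or it visits a vertex twice and then contains a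
    shorter closed path, which contracts by induction. Quantifying over [Q]
    inside the induction is what allows the contraction of that subpath to take
    place in the context of the whole path. *)
Lemma closed_path_ind p v :
  edge_path v p v -> (forall e, e \in p -> S e) ->
  forall Q : seq (edge X) -> Prop, Q [::] ->
    (forall a e b, S e -> Q (a ++ b) -> Q (a ++ e :: inv_edge e :: b)) -> Q p.
Proof.
have [n] := ubnP (size p); elim: n => // n IH in p v *.
rewrite ltnS => pn pv pS Q Q0 Qcancel.
have [->//|p_neq0] := eqVneq p [::].
have [p_sorted|/not_sorted_split] :=
  boolP (sorted (fun e f => f != inv_edge e) p); last first.
  case=> [a [e [f [b [p_eq /negPn/eqP f_eq]]]]]; subst f; subst p.
  move/edge_path_cat: pv => [u au /= [oe [_]]].
  rewrite targ_inv_edge oe => bv; apply: (Qcancel); first by apply: pS;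
    rewrite mem_cat !inE eqxx orbT.
  apply: (IH _ v) => //.
  - by apply: leq_trans pn; rewrite !size_cat /= !addnS ltnS leqnSn.
  - by apply/edge_path_cat; exists u.
  - by move=> f; rewrite mem_cat => /orP[] fab; apply: pS;
      rewrite mem_cat ?inE fab ?orbT.
have [p_uniq|/not_uniq_map_split] := boolP (uniq (map (@targ X) p)).
  by case: (circuit_free (p := p)); split=> //; [exact/eqP | exists v].
case=> [a [e [b [f [c [p_eq ef]]]]]]; subst p.
have p_eq : a ++ e :: b ++ f :: c = (a ++ [:: e]) ++ (b ++ [:: f]) ++ c.
  by rewrite -!catA.
rewrite p_eq in pv pS *; move/edge_path_cat: pv => [u au].
case/edge_path_cat=> w bw cv.
have ue : u = targ e by case/edge_path_cat: au => ? _ /= [_ <-].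
have wf : w = targ f by case/edge_path_cat: bw => ? _ /= [_ <-].
move: bw cv; rewrite wf -ef -ue => bw cv.
(* The subpath [b ++ [:: f]] is closed: contract it in place, then the rest. *)
pose Q' s := Q ((a ++ [:: e]) ++ s ++ c).
apply: (IH _ u _ bw _ Q') => [|g gb||x g y gS]; rewrite /Q'.
- apply: leq_trans pn; rewrite p_eq !size_cat -add1n.
  exact: leq_add (leq_addl _ _) (leq_addr _ _).
- by apply: pS; rewrite mem_cat (mem_cat _ _ c) gb orbT.
- apply: (IH _ v _ _ _ Q) => //=.
  + apply: leq_trans pn; rewrite p_eq !size_cat ltn_add2l -add1n leq_add2r.
    exact: leq_addl.
  + by apply/edge_path_cat; exists u.
  + move=> g; rewrite mem_cat => /orP[] gac; apply: pS; rewrite mem_cat ?gac //.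
    by rewrite (mem_cat _ _ c) gac !orbT.
- have catE s : (a ++ [:: e]) ++ (x ++ s) ++ c = ((a ++ [:: e]) ++ x) ++ s ++ c.
    by rewrite !catA.
  by rewrite !catE; exact: Qcancel.
Qed.

Hypothesis S_connected : connected_subgraph setT S.

(** A labelling of the edges of a tree by group elements, inverse edges having
    inverse labels, is a coboundary: the product of the labels along a path
    depends only on its end points, as it is 1 on closed paths. *)
Lemma edge_potential (K : groupType) (c : edge X -> K) :
  (forall e, S e -> c (inv_edge e) = (c e)^-1) ->
  exists b : vertex X -> K, forall e, S e -> b (targ e) = b (orig e) * c e.
Proof.
move=> c_inv; pose hol p := \prod_(e <- p) c e.
have hol_cat p q : hol (p ++ q) = hol p * hol q by exact: big_cat.
have hol_closed v p :
    edge_path v p v -> (forall e, e \in p -> S e) -> hol p = 1.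
  move=> pv pS.
  apply: (closed_path_ind pv pS (Q := fun p => hol p = 1)) => [|a e b eS].
    exact: big_nil.
  by rewrite !hol_cat /hol !big_cons c_inv // mulVKg.
have [v0|novertex] := pselect (inhabited (vertex X)); last first.
  by exists (fun=> 1) => e; case: novertex; exists; exact: targ e.
case: v0 => v0.
have hol_eq v p q : edge_path v0 p v -> edge_path v0 q v ->
    (forall e, e \in p -> S e) -> (forall e, e \in q -> S e) -> hol p = hol q.
  move=> pv qv pS qS; have [r [rv rS]] := @S_connected v v0 I I.
  have loop s : edge_path v0 s v -> (forall e, e \in s -> S e) ->
      hol s * hol r = 1.
    move=> sv sS; rewrite -hol_cat; apply: (hol_closed v0) => [|e].
      by apply/edge_path_cat; exists v.
    by rewrite mem_cat => /orP[/sS|/rS].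
  by apply: (mulIg (hol r)); rewrite !loop.
have [t tP] := choice (fun v => @S_connected v0 v I I).
exists (hol \o t) => e eS /=.
have [[to oS] [tt tS]] := (tP (orig e), tP (targ e)).
have -> : c e = hol [:: e] by rewrite /hol big_seq1.
rewrite -hol_cat.
apply: (hol_eq (targ e)) => //; first by apply/edge_path_cat; exists (orig e).
by move=> f; rewrite mem_cat inE => /orP[/oS//|/eqP->].
Qed.

End CircuitFree.

Lemma boundary_edge W v w p :
  edge_path v p w -> W v -> ~ W w -> exists e, W (orig e) /\ ~ W (targ e).
Proof.
elim: p v => [|e p IH] v /= => [->//|[<- pw] We nWw].
by have [/(IH _ pw)|nWe] := pselect (W (targ e)); [exact | exists e].
Qed.

(** A circuit through the new edge would have to turn back at the new vertex,
    where no other edge is available. *)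
Lemma add_leaf_circuit_free W S e :
  subgraph W S -> (forall p, ~ circuit S p) -> W (orig e) -> ~ W (targ e) ->
  forall p, ~ circuit (S `|` [set e; inv_edge e]) p.
Proof.
move=> [S_inv S_end] S_free We nWe p [p_neq0 [v pv] pS p_sorted p_uniq].
have orig_leaf f : f \in p -> orig f = targ e -> f = inv_edge e.
  move=> /pS[/S_end[] + _|[->|->//]] fo; first by rewrite fo.
  by move: We nWe; rewrite fo.
have targ_leaf f : f \in p -> targ f = targ e -> f = e.
  move=> /pS[/S_end[] _ +|[->//|->]] ft; first by rewrite ft.
  by move: We nWe; rewrite -ft targ_inv_edge.
have no_backtrack a b f : p <> a ++ f :: inv_edge f :: b.
  move=> p_eq; move: p_sorted; rewrite p_eq => /cat_sorted2[_] /=.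
  by rewrite eqxx.
have inv_notin : inv_edge e \notin p.
  apply/negP => /path.splitPr p_eq.
  case: p_eq pv no_backtrack p_uniq targ_leaf => a b.
  (* Linear sortedness does not forbid backtracking from the last edge to the
     first one, so a circuit based at the new vertex is excluded by the
     distinctness of its targets. *)
  case/lastP: a => [|a f].
    move=> /= [ov]; rewrite orig_inv_edge in ov; subst v.
    rewrite targ_inv_edge; case/lastP: b => [/= ev|b f bv].
      by move: nWe; rewrite -ev.
    have ft : targ f = targ e by exact: edge_path_rcons bv.
    move=> + + /(_ f _ ft) f_e; have {f_e ft} f_e : f = e.
      by apply: f_e; rewrite inE mem_rcons mem_head orbT.
    subst f.
    rewrite -cats1 in bv; case/edge_path_cat: bv => u bu /= [ou _].
    case/lastP: b bu => [_ /(_ [::] [::] (inv_edge e))|b g bu _].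
      by rewrite inv_edgeK.
    rewrite /= !map_rcons !(mem_rcons, inE).
    by rewrite (edge_path_rcons bu) -ou eqxx orbT.
  move=> pv; case/edge_path_cat: pv => u au /= [ou _].
  rewrite orig_inv_edge in ou; subst u.
  move=> + _ targ_leaf; rewrite (targ_leaf f); last exact: edge_path_rcons au.
    by move=> /(_ a b e); rewrite cat_rcons.
  by rewrite mem_cat mem_rcons mem_head.
have e_notin : e \notin p.
  apply/negP => /path.splitPr p_eq.
  case: p_eq pv inv_notin orig_leaf
    {p_neq0 p_uniq p_sorted targ_leaf no_backtrack} => a b.
  move=> pv; case/edge_path_cat: pv => u au /= [ou bv] inv_notin orig_leaf.
  have inv_in f : f \in a ++ e :: b -> orig f = targ e -> False.
    move=> fp /(orig_leaf _ fp) f_eq.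
    by move: inv_notin; rewrite -f_eq fp.
  case: b bv inv_in {inv_notin orig_leaf pS}
    => [/= ev inv_in|f b /= [of_ _] inv_in].
    case: a au inv_in => [/= vu|f a [of_ _]] inv_in.
      by apply: (inv_in e); rewrite ?mem_head // ou -vu.
    by apply: (inv_in f); rewrite ?mem_head // of_.
  by apply: (inv_in f); rewrite // mem_cat !inE eqxx !orbT.
apply: (S_free p); split=> //; first by exists v.
move=> f fp; case: (pS f fp) => // -[] f_eq; move: fp; rewrite f_eq => fp.
  by rewrite fp in e_notin.
by rewrite fp in inv_notin.
Qed.

(** Otherwise an edge leaving the subtree could be added to it. *)
Lemma maximal_subtree_spans S W v :
  connected_graph X -> maximal_subtree W S -> W v.
Proof.
move=> X_conn [[[S_inv S_end] [w Ww] W_conn S_free] S_max].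
apply: contrapT => nWv.
have [p [wv _]] := X_conn w v I I.
have [e [We nWe]] := boundary_edge wv Ww nWv.
pose S' := S `|` [set e; inv_edge e]; pose W' := W `|` [set targ e].
suff : subtree W' S'.
  move=> S'_tree; have [W_eq _] := S_max _ _ S'_tree (@subsetUl _ _ _)
    (@subsetUl _ _ _).
  by apply: nWe; rewrite -W_eq; right.
have S'e f : f \in [:: e; inv_edge e] -> S' f.
  by rewrite !inE => /orP[]/eqP->; right; [left|right].
split.
- split=> f [Sf|[]->]; rewrite ?inv_edgeK ?orig_inv_edge ?targ_inv_edge.
  + by left; exact: S_inv.
  + by right; right.
  + by right; left.
  + by have [] := S_end f Sf; split; left.
  + by split; [left|right].
  + by split; [right|left].
- by exists w; left.
- suff to_W u : W' u -> (exists2 x, W x & exists p, edge_path u p x /\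
      forall f, f \in p -> S' f) /\ (exists2 x, W x & exists p,
      edge_path x p u /\ forall f, f \in p -> S' f).
    move=> u u' /to_W[[x Wx [a [ax aS]]] _] /to_W[_ [y Wy [b [yb bS]]]].
    have [c [xy cS]] := W_conn x y Wx Wy; exists (a ++ c ++ b); split.
      apply/edge_path_cat; exists x => //.
      by apply/edge_path_cat; exists y.
    move=> f; rewrite !mem_cat => /or3P[/aS|/cS|/bS] //.
    by left.
  case=> [Wu|->].
    by split; exists u => //; exists [::].
  split; exists (orig e) => //.
    exists [:: inv_edge e]; split.
      by rewrite /= orig_inv_edge targ_inv_edge.
    by move=> f fe; apply: S'e; rewrite inE fe orbT.
  exists [:: e]; split=> // f; rewrite inE => fe.
  by apply: S'e; rewrite inE fe.
- exact: (add_leaf_circuit_free (conj S_inv S_end)) nWe.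
Qed.

End Graphs.

(** * Actions of the fundamental group *)

Section AutomorphismGroup.
Variables (Omega : Type) (sigma : Omega -> Omega).

(** The permutations that commute with [sigma]: with [sigma] the identity, the
    symmetric group; with [sigma] a free involution, the automorphisms of a
    double cover. *)
Record automorphism := Automorphism {
  autom :> Omega -> Omega;
  autom_inv : Omega -> Omega;
  automK : cancel autom autom_inv;
  autom_invK : cancel autom_inv autom;
  autom_comm : forall x, autom (sigma x) = sigma (autom x)
}.

HB.instance Definition _ := gen_eqMixin automorphism.
HB.instance Definition _ := gen_choiceMixin automorphism.

Lemma autom_ext (f g : automorphism) : f =1 g -> f = g.
Proof.
case: f g => [f f' fK f'K fs] [g g' gK g'K gs] /= /funext fg; subst g.
have f'g' : f' = g' by apply/funext => x; rewrite -{1}[x]g'K fK.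
by subst g'; congr Automorphism; exact: Prop_irrelevance.
Qed.

Definition autom_one : automorphism :=
  @Automorphism id id (fun=> erefl) (fun=> erefl) (fun=> erefl).

Definition autom_mul (f g : automorphism) : automorphism.
Proof.
refine (@Automorphism (f \o g) (autom_inv g \o autom_inv f) _ _ _).
- exact: can_comp (automK f) (automK g).
- exact: can_comp (autom_invK g) (autom_invK f).
- by move=> x /=; rewrite !autom_comm.
Defined.

Definition autom_inverse (f : automorphism) : automorphism.
Proof.
refine (@Automorphism (autom_inv f) f (autom_invK f) (automK f) _).
by move=> x; apply: (can_inj (automK f)); rewrite autom_comm !autom_invK.
Defined.

Lemma autom_mulA : associative autom_mul.
Proof. by move=> f g h; apply: autom_ext. Qed.

Lemma autom_mul1 : left_id autom_one autom_mul.
Proof. by move=> f; apply: autom_ext. Qed.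

Lemma autom_mulr1 : right_id autom_one autom_mul.
Proof. by move=> f; apply: autom_ext. Qed.

Lemma autom_mulV : left_inverse autom_one autom_inverse autom_mul.
Proof. by move=> f; apply: autom_ext => x /=; rewrite automK. Qed.

Lemma autom_mulrV : right_inverse autom_one autom_inverse autom_mul.
Proof. by move=> f; apply: autom_ext => x /=; rewrite autom_invK. Qed.

HB.instance Definition _ := isGroup.Build automorphism
  autom_mulA autom_mul1 autom_mulr1 autom_mulV autom_mulrV.

Lemma autom_mulE (f g : automorphism) x : (f * g) x = f (g x).
Proof. by []. Qed.

End AutomorphismGroup.

Section Presented.
Variables (gen : choiceType) (R : word gen -> word gen -> Prop) (K : groupType).
Variable F : gen -> K.

Definition eval_letter (x : gen * bool) : K :=
  if x.2 then (F x.1)^-1 else F x.1.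

Definition eval_word (u : word gen) : K := \prod_(x <- u) eval_letter x.

Lemma eval_word_cat u v : eval_word (u ++ v) = eval_word u * eval_word v.
Proof. exact: big_cat. Qed.

Hypothesis F_rel : forall u v, R u v -> eval_word u = eval_word v.

Lemma eval_word_eq u v : word_eq R u v -> eval_word u = eval_word v.
Proof.
elim=> [|x b|u1 u2 v1 v2 _ IHu _ IHv|||] //.
- rewrite /eval_word !big_cons big_nil mulg1.
  by case: b; rewrite /eval_letter /= ?mulVg ?mulgV.
- by rewrite !eval_word_cat IHu IHv.
- by move=> {}u {}v w _ -> _ ->.
Qed.

Definition presented_lift (a : presented R) : K := eval_word (repr a).

Lemma presented_lift_pi u : presented_lift (\pi_(presented R) u) = eval_word u.
Proof. exact/eval_word_eq/repr_pi_word. Qed.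

Lemma presented_lift_generator x : presented_lift (generator R x) = F x.
Proof. by rewrite presented_lift_pi /eval_word big_seq1. Qed.

Lemma presented_pi_cat u v :
  \pi_(presented R) (u ++ v) = \pi_(presented R) u * \pi_(presented R) v.
Proof. by rewrite -presented_mulE. Qed.

Lemma presented_liftM : {morph presented_lift : a b / a * b}.
Proof.
move=> a b; have [u ->] := presented_pi a; have [v ->] := presented_pi b.
by rewrite -presented_pi_cat !presented_lift_pi eval_word_cat.
Qed.

End Presented.

Section FundamentalGroup.
Variables (X : serre_graph) (GG : graph_of_groups X) (A T : set (edge X)).

Local Notation G := (fund_group GG A T).
Local Notation ov := (of_vertex GG A T).

Lemma of_vertexM v (g h : vgroup GG v) : ov (g * h) = ov g * ov h.
Proof.
rewrite /of_vertex /generator -presented_pi_cat.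
by apply/presented_eqP/word_eq_sym/word_eq_rel; constructor.
Qed.

Lemma of_vertex1 v : ov (1 : vgroup GG v) = 1.
Proof.
by apply: (mulgI (ov (1 : vgroup GG v))); rewrite -of_vertexM !mulg1.
Qed.

Lemma of_vertexV v (g : vgroup GG v) : ov g^-1 = (ov g)^-1.
Proof. by apply: (mulgI (ov g)); rewrite -of_vertexM !mulgV of_vertex1. Qed.

(** The element of the fundamental group by which an edge of [T] or [A] acts:
    the edges of [T] are trivial. The value 1 on the remaining edges is a
    default. *)
Definition edge_elt (e : edge X) : G :=
  if pselect (A e) is left Ae then of_edge GG T (exist _ e (mem_set Ae)) else 1.

Lemma edge_elt1 e : ~ A e -> edge_elt e = 1.
Proof. by rewrite /edge_elt; case: pselect. Qed.

Hypothesis AT0 : A `&` T = set0.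

Lemma edge_elt_tree e : T e -> edge_elt e = 1.
Proof.
by move=> Te; apply: edge_elt1 => Ae; rewrite -[False]/(set0 e) -AT0.
Qed.

Lemma edge_elt_comm e (g : egroup GG e) : (T `|` A) e ->
  ov (emb_orig GG e g) * edge_elt e = edge_elt e * ov (emb_targ GG e g).
Proof.
case=> [Te|Ae].
  rewrite edge_elt_tree // mul1g mulg1.
  by apply/presented_eqP/word_eq_rel; constructor.
rewrite /edge_elt; case: pselect => [{}Ae|//].
set a : A := exist _ _ _; rewrite /of_vertex /of_edge /generator.
rewrite -!presented_pi_cat; apply/presented_eqP/word_eq_rel.
exact: (@fund_rel_edge _ _ _ _ a g).
Qed.


(** An edge and its inverse have the same edge group with the two embeddings
    exchanged. The equations of [graph_of_groups] that say so live in the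
    disjoint union of the vertex groups, to which [tot] extends [alpha]. *)
Lemma intertwine_inv (K : groupType) (alpha : forall v, vgroup GG v -> K) e
    (d : K) :
  (forall g, alpha _ (emb_orig GG (inv_edge e) g) * d =
             d * alpha _ (emb_targ GG (inv_edge e) g)) ->
  forall g, alpha _ (emb_orig GG e g) * d^-1 =
            d^-1 * alpha _ (emb_targ GG e g).
Proof.
move=> comm g; pose tot (u : {v & vgroup GG v}) := alpha (tag u) (tagged u).
have := comm (eflip GG e g).
have := congr1 tot (emb_targ_flip g); have := congr1 tot (emb_orig_flip g).
rewrite /tot /= => -> -> comm_g; apply: (mulgI d).
by rewrite mulVKg mulgA -comm_g mulgK.
Qed.

Hypothesis T_tree : [/\ connected_subgraph setT T,
  forall e, T e -> T (inv_edge e) & forall p, ~ circuit T p].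

(** Given compatible actions [alpha] of the vertex groups and intertwining
    elements [c] of the edges, the tree relations can be achieved by conjugating
    the action of [G_v] by [b v], where [b] is a potential of [c] on [T]. *)
Lemma fund_group_rep (K : groupType) (alpha : forall v, vgroup GG v -> K)
    (c : edge X -> K) :
  (forall v g h, alpha v (g * h) = alpha v g * alpha v h) ->
  (forall e, T e -> c (inv_edge e) = (c e)^-1) ->
  (forall e g, (T `|` A) e ->
     alpha _ (emb_orig GG e g) * c e = c e * alpha _ (emb_targ GG e g)) ->
  exists (Phi : G -> K) (b : vertex X -> K),
    [/\ {morph Phi : x y / x * y},
        forall v (g : vgroup GG v), Phi (ov g) * b v = b v * alpha v g &
        forall e, (T `|` A) e ->
          Phi (edge_elt e) * b (targ e) = b (orig e) * c e].
Proof.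
move=> alphaM c_inv comm; have [T_conn T_inv T_free] := T_tree.
have [b bP] := edge_potential T_free T_conn c_inv.
pose F (x : fund_gen GG A) := match x with
  | inl u => b (tag u) * alpha _ (tagged u) * (b (tag u))^-1
  | inr a => b (orig (val a)) * c (val a) * (b (targ (val a)))^-1
  end.
have F_rel u v : fund_rel (A := A) T u v -> eval_word F u = eval_word F v.
  rewrite /eval_word /eval_letter; case=> [w g h|a g|e g Te];
    rewrite !big_cons !big_nil /= ?mulg1.
  - by rewrite alphaM !mulgA mulgVK.
  - rewrite !mulgA !mulgVK -2!(mulgA (b _)) comm ?mulgA //.
    by right; exact: set_valP.
  - by rewrite bP // invgM -(mulgA (b _) (c e)) -comm ?mulgA ?mulgK //; left.
pose Phi := presented_lift (R := fund_rel (A := A) T) F.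
have PhiM : {morph Phi : x y / x * y} by exact: presented_liftM.
exists Phi, b; split=> // [v g|e Ee].
  by rewrite /Phi presented_lift_generator //= mulgVK.
have [Ae|nAe] := pselect (A e).
  rewrite /edge_elt; case: pselect => // {}Ae.
  by rewrite /Phi presented_lift_generator //= mulgVK.
have Te : T e by case: Ee.
rewrite edge_elt1 // -bP //; apply: (mulgI (Phi 1)).
by rewrite mulgA -PhiM mul1g.
Qed.

End FundamentalGroup.

(** * Vertex groups embed into the fundamental group *)

Section DependentUpdate.
Variables (I : eqType) (F : I -> Type).
Implicit Types (f : forall i, F i).

Lemma dfwith_self f i : dfwith f (f i) = f.
Proof. by apply/functional_extensionality_dep => j; case: dfwithP. Qed.

Lemma dfwith_twice f i (x y : F i) : dfwith (dfwith f x) y = dfwith f y.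
Proof.
apply/functional_extensionality_dep => j; have [<-|ij] := eqVneq i j.
  by rewrite !dfwith_in.
by rewrite !dfwith_out.
Qed.

End DependentUpdate.

Lemma morph_one (H K : groupType) (i : {multiplicative H -> K}) : i 1 = 1.
Proof. by apply: (mulgI (i 1)); rewrite -gmulfM !mulg1. Qed.

Lemma morph_inv (H K : groupType) (i : {multiplicative H -> K}) x :
  i x^-1 = (i x)^-1.
Proof. by apply: (mulgI (i x)); rewrite -gmulfM !mulgV morph_one. Qed.

(** [K] is a free [H]-set, hence [H] times a set of orbit representatives [r];
    [kappa] is the first coordinate. *)
Lemma equivariant_retraction (H K : groupType) (i : {multiplicative H -> K}) :
  injective i -> exists kappa : K -> H, forall h x,
    kappa (i h * x) = h * kappa x.
Proof.
move=> i_inj; pose orbit x := [set y | exists h, x = i h * y].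
pose r x := xget 1 (orbit x).
have rP x : exists h, x = i h * r x.
  by apply: (@xgetPex _ 1 (orbit x)); exists x, 1; rewrite morph_one mul1g.
have r_orbit h x : r (i h * x) = r x.
  congr xget; apply/seteqP; split=> y [k].
    by move=> xy; exists (h^-1 * k); rewrite gmulfM morph_inv -mulgA -xy mulKg.
  by move=> ->; exists (h * k); rewrite gmulfM mulgA.
have [kappa kappaP] := choice rP; exists kappa => h x.
apply: i_inj; apply: (mulIg (r x)).
by rewrite gmulfM -mulgA -kappaP -(r_orbit h) -kappaP.
Qed.

Section Orientation.
Variable X : serre_graph.
Implicit Types e : edge X.

(** The chosen element of the pair of [e] and [inv_edge e] depends on the pair
    only, so exactly one of the two is oriented. *)
Definition oriented e : bool := choose (pred2 e (inv_edge e)) e == e.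

Lemma oriented_inv e : oriented (inv_edge e) = ~~ oriented e.
Proof.
pose r := choose (pred2 e (inv_edge e)) e.
have r_inv :
    choose (pred2 (inv_edge e) (inv_edge (inv_edge e))) (inv_edge e) = r.
  rewrite inv_edgeK (eq_choose (Q := pred2 e (inv_edge e))); last first.
    by move=> f /=; rewrite orbC.
  by apply: choose_id; rewrite /= eqxx ?orbT.
have : pred2 e (inv_edge e) r by apply: chooseP; rewrite /= eqxx.
have ee := inv_edge_neq (e := e).
rewrite /oriented r_inv -/r /= => /orP[]/eqP->; rewrite eqxx.
  by apply/eqP => /esym.
by apply/esym/negP => /eqP.
Qed.

End Orientation.

Section Embedding.
Variables (X : serre_graph) (GG : graph_of_groups X) (A T : set (edge X)).
Hypothesis T_tree : [/\ connected_subgraph setT T,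
  forall e, T e -> T (inv_edge e) & forall p, ~ circuit T p].

Let Y := forall v, vgroup GG v.
Let Aut := automorphism (@id (Y * Y)).

(** [G_v] acts on the coordinate [v] of the first copy of the product of all
    vertex groups. The second copy is a spare that keeps [edge_exchange]
    uniform, in particular for loops. *)
Definition shift_fun v (g : vgroup GG v) (z : Y * Y) : Y * Y :=
  (dfwith z.1 (g * z.1 v), z.2).

Lemma shift_funK v (g h : vgroup GG v) :
  h * g = 1 -> cancel (shift_fun g) (shift_fun h).
Proof.
move=> hg [x y]; rewrite /shift_fun /= dfwith_twice dfwith_in mulgA hg mul1g.
by rewrite dfwith_self.
Qed.

Definition shift_main v (g : vgroup GG v) : Aut :=
  @Automorphism _ id _ _ (shift_funK (mulVg g)) (shift_funK (mulgV g))
    (fun=> erefl).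

Lemma shift_mainE v (g : vgroup GG v) x y :
  shift_main g (x, y) = (dfwith x (g * x v), y).
Proof. by []. Qed.

Lemma shift_mainM v (g h : vgroup GG v) :
  shift_main (g * h) = shift_main g * shift_main h.
Proof.
apply: autom_ext => -[x y]; rewrite autom_mulE !shift_mainE /=.
by rewrite dfwith_twice dfwith_in mulgA.
Qed.

(** The coordinate at [targ e] in the first copy and the one at [orig e] in the
    second are each [G_e] times something. Exchanging the two components in
    [G_e] and then the two copies carries one action of [G_e] to the other. *)
Lemma edge_exchange e : exists d : Aut, forall g,
  shift_main (emb_orig GG e g) * d = d * shift_main (emb_targ GG e g).
Proof.
have [kt ktP] := equivariant_retraction (@emb_targ_inj _ GG e).
have [ko koP] := equivariant_retraction (@emb_orig_inj _ GG e).
pose swap (z : Y * Y) : Y * Y := (z.2, z.1).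
pose exch (z : Y * Y) : Y * Y :=
  let a := kt (z.1 (targ e)) in let b := ko (z.2 (orig e)) in
  (dfwith z.1 (emb_targ GG e (b / a) * z.1 (targ e)),
   dfwith z.2 (emb_orig GG e (a / b) * z.2 (orig e))).
have exchK : involutive exch.
  move=> [x y]; rewrite /exch /= !dfwith_in !dfwith_twice ktP koP !mulgVK.
  by rewrite !mulgA -!gmulfM !mulgA !mulgVK !mulgV !morph_one !mul1g
    !dfwith_self.
have swapK : involutive swap by case.
pose d : Aut := @Automorphism _ (@id (Y * Y)) (swap \o exch) (exch \o swap)
  (can_comp swapK exchK) (can_comp exchK swapK) (fun=> erefl).
exists d => g; apply: autom_ext => -[x y]; rewrite !autom_mulE.
have dE z : d z = swap (exch z) by [].
rewrite !dE [in RHS]shift_mainE /swap /exch /= /shift_fun /= !dfwith_twice.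
rewrite !dfwith_in ktP; congr pair.
  by rewrite !mulgA -gmulfM mulgA.
by rewrite mulgA -gmulfM invgM mulgA mulgVK.
Qed.

Lemma of_vertex_inj v : injective (of_vertex GG A T (v := v)).
Proof.
have [d dP] := choice (@edge_exchange).
pose c e := if oriented e then d e else (d (inv_edge e))^-1.
have c_inv e : T e -> c (inv_edge e) = (c e)^-1.
  by rewrite /c oriented_inv inv_edgeK; case: oriented; rewrite ?invgK.
have c_comm e g : (T `|` A) e -> shift_main (emb_orig GG e g) * c e =
    c e * shift_main (emb_targ GG e g).
  move=> _; rewrite /c; case: oriented; first exact: dP.
  exact: (intertwine_inv (alpha := shift_main)).
have [Phi [b [_ Phi_v _]]] := fund_group_rep T_tree shift_mainM c_inv c_comm.
move=> g h gh; have := Phi_v v h; rewrite -gh Phi_v => /mulgI.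
move/(congr1 (fun f : Aut => (f (fun=> 1, fun=> 1)).1 v)).
by rewrite /= /shift_fun /= !dfwith_in !mulg1.
Qed.

End Embedding.

(** * Edges separate the Bass-Serre tree *)

Section HalfTrees.
Variables (X : serre_graph) (GG : graph_of_groups X) (A T : set (edge X)).
Hypothesis AT0 : A `&` T = set0.
Hypothesis T_tree : [/\ connected_subgraph setT T,
  forall e, T e -> T (inv_edge e) & forall p, ~ circuit T p].

Hypothesis no_return : forall e, A e -> ~ (T `|` A) (inv_edge e).

Local Notation G := (fund_group GG A T).
Local Notation ov := (of_vertex GG A T).
Local Notation el := (edge_elt GG A T).

(** The elements at [orig e] from which one crosses the same edge of the
    Bass-Serre tree as from 1. *)
Definition edge_coset e : set G := range (fun g => ov (emb_orig GG e g)).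

Lemma edge_cosetM e g x : edge_coset e (ov (emb_orig GG e g) * x) <->
  edge_coset e x.
Proof.
split=> -[h _].
  move=> hx; exists (g^-1 * h) => //.
  by rewrite gmulfM of_vertexM hx morph_inv of_vertexV mulKg.
by move=> <-; exists (g * h) => //; rewrite gmulfM of_vertexM.
Qed.

Lemma edge_cosetV e x : edge_coset e x -> edge_coset e x^-1.
Proof.
by case=> g _ <-; exists g^-1 => //; rewrite morph_inv of_vertexV.
Qed.

Lemma edge_coset1 e : edge_coset e 1.
Proof. by exists 1; rewrite // morph_one of_vertex1. Qed.

Let flip (z : G * bool) := (z.1, ~~ z.2).
Let Aut := automorphism flip.

Lemma addb_fun_cancel (x y : G) (d : G -> bool) :
  x * y = 1 -> cancel (fun z : G * bool => (y * z.1, z.2 (+) d (y * z.1)))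
                      (fun z : G * bool => (x * z.1, z.2 (+) d z.1)).
Proof. by move=> xy [z b] /=; rewrite mulgA xy mul1g addbK. Qed.

Lemma addb_fun_cancel_inv (x y : G) (d : G -> bool) :
  y * x = 1 -> cancel (fun z : G * bool => (x * z.1, z.2 (+) d z.1))
                      (fun z : G * bool => (y * z.1, z.2 (+) d (y * z.1))).
Proof. by move=> yx [z b] /=; rewrite mulgA yx mul1g addbK. Qed.

Lemma addb_fun_flip (x : G) (d : G -> bool) z :
  (x * (flip z).1, (flip z).2 (+) d (x * (flip z).1)) =
  flip (x * z.1, z.2 (+) d (x * z.1)).
Proof. by rewrite /flip /= addNb. Qed.

(** Left translation by [x], with the sheets exchanged over [d]. *)
Definition cover_shift (x : G) (d : G -> bool) : Aut :=
  Automorphism (addb_fun_cancel d (mulVg x)) (addb_fun_cancel_inv d (mulgV x))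
    (addb_fun_flip x d).

Lemma cover_shiftE x d y b :
  cover_shift x d (y, b) = (x * y, b (+) d (x * y)).
Proof. by []. Qed.

Lemma cover_shiftVE x d y b :
  (cover_shift x d)^-1 (y, b) = (x^-1 * y, b (+) d y).
Proof. by []. Qed.

(** The move from [g] to [g * el f] passes through the edge of the Bass-Serre
    tree that joins 1 to [el e], in either direction. *)
Definition crosses e f (g : G) : Prop :=
  (f = e /\ edge_coset e g) \/ (f = inv_edge e /\ edge_coset e (g * el f)).

(** Every element of [G] acts on the double cover [G * bool]: vertex groups and
    edges other than [e] act by translation, and [e] also exchanges the sheets
    over [edge_coset e]. The sheet on which [g * b v] sends the point of the
    base sheet over [g^-1] records the parity of the number of crossings of the
    edge on a path from the base point to [(g, v)]. *)
Lemma half_tree e : (T `|` A) e -> exists s : G -> vertex X -> bool,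
  [/\ forall g v (h : vgroup GG v), s (g * ov h) v = s g v,
      forall g f, (T `|` A) f ->
        s (g * el f) (targ f) = s g (orig f) (+) `[< crosses e f g >] &
      s 1 (orig e) = false].
Proof.
move=> Ee; have [_ T_inv _] := T_tree.
pose alpha v (h : vgroup GG v) : Aut := cover_shift (ov h) (fun=> false).
pose twist : Aut := cover_shift (el e) (fun x => `[< edge_coset e x >]).
pose c f : Aut := if f == e then twist else
  if f == inv_edge e then twist^-1 else cover_shift (el f) (fun=> false).
have ee : (inv_edge e == e) = false by apply/eqP/inv_edge_neq.
have alphaM v g h : alpha v (g * h) = alpha v g * alpha v h.
  apply: autom_ext => -[x b]; rewrite autom_mulE !cover_shiftE /=.
  by rewrite of_vertexM mulgA !addbF.
have c_inv f : T f -> c (inv_edge f) = (c f)^-1.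
  move=> Tf; have eK := @inv_edgeK X.
  rewrite /c (can2_eq eK eK) (inj_eq (can_inj eK)).
  have [->|fe] := eqVneq f e; first by rewrite eq_sym ee.
  have [_|_] := eqVneq f (inv_edge e); first by rewrite invgK.
  apply: autom_ext => -[x b]; rewrite cover_shiftVE cover_shiftE !addbF /=.
  by rewrite !edge_elt_tree ?invg1 //; exact: T_inv.
have twist_comm g : alpha _ (emb_orig GG e g) * twist =
    twist * alpha _ (emb_targ GG e g).
  apply: autom_ext => -[x b]; rewrite !autom_mulE !cover_shiftE /= !addbF.
  rewrite !mulgA -edge_elt_comm // -mulgA; congr (_, _ (+) _).
  by apply: asbool_equiv_eq; apply: iff_sym; exact: edge_cosetM.
have c_comm f g : (T `|` A) f -> alpha _ (emb_orig GG f g) * c f =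
    c f * alpha _ (emb_targ GG f g).
  move=> Ef; rewrite /c; have [fe|fe] := eqVneq f e; first by subst f.
  have [fe'|_] := eqVneq f (inv_edge e).
    apply: intertwine_inv; rewrite fe' inv_edgeK; exact: twist_comm.
  apply: autom_ext => -[x b]; rewrite !autom_mulE !cover_shiftE /= !addbF.
  by rewrite !mulgA edge_elt_comm.
have [Phi [b [PhiM Phi_v Phi_e]]] := fund_group_rep T_tree alphaM c_inv c_comm.
pose s g v := ((Phi g * b v) (g^-1, false)).2.
have flipE (f : Aut) x (eps : bool) : (f (x, eps)).2 = (f (x, false)).2 (+) eps.
  case: eps; last by rewrite addbF.
  by rewrite (autom_comm f (x, false)) /= addbT.
have s_v g v (h : vgroup GG v) : s (g * ov h) v = s g v.
  rewrite /s PhiM -mulgA Phi_v mulgA autom_mulE cover_shiftE.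
  by rewrite invgM mulVKg.
have s_e g f : (T `|` A) f ->
    s (g * el f) (targ f) = s g (orig f) (+) `[< crosses e f g >].
  move=> Ef; rewrite /s PhiM -mulgA Phi_e // mulgA autom_mulE invgM /c /crosses.
  have [fe|fe] := eqVneq f e.
    subst f; rewrite cover_shiftE mulVKg addFb flipE; congr (_ (+) _).
    apply: asbool_equiv_eq; split=> [/edge_cosetV|].
      by rewrite invgK; left.
    by case=> [[_ /edge_cosetV]//|[/esym/inv_edge_neq]].
  have [fe'|fe'] := eqVneq f (inv_edge e).
    have Te : T e by case: Ee => // Ae; case: (no_return Ae); rewrite -fe'.
    rewrite cover_shiftVE addFb (edge_elt_tree _ AT0 Te) invg1 mul1g fe'.
    rewrite (edge_elt_tree _ AT0 (T_inv _ Te)) invg1 mul1g mulg1 flipE.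
    congr (_ (+) _).
    apply: asbool_equiv_eq; split=> [/edge_cosetV|].
      by rewrite invgK; right.
    by case=> [[/inv_edge_neq]|[_]] // /edge_cosetV.
  rewrite cover_shiftE mulVKg asboolF ?addbF //.
  by case=> -[/eqP]; rewrite ?(negbTE fe) ?(negbTE fe').
(* Nothing is known about the potential [b] at [orig e]: normalize [s] there. *)
exists (fun g v => s g v (+) s 1 (orig e)); split=> [g v h|g f Ef|].
- by rewrite s_v.
- by rewrite s_e // addbAC.
- exact: addbb.
Qed.

End HalfTrees.

(** * Positive paths *)

Section PositivePaths.
Variables (X : serre_graph) (GG : graph_of_groups X) (A T : set (edge X)).
Variable P : forall v, set (vgroup GG v).
Arguments P : clear implicits.
Hypothesis AT0 : A `&` T = set0.
Hypothesis T_tree : [/\ connected_subgraph setT T,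
  forall e, T e -> T (inv_edge e) & forall p, ~ circuit T p].
Hypothesis no_return : forall e, A e -> ~ (T `|` A) (inv_edge e).
Hypothesis P_cone : forall v, positive_cone (P v).
Hypothesis P_tree : forall e, T e -> cone_targ P e = cone_orig P e.

Local Notation G := (fund_group GG A T).
Local Notation ov := (of_vertex GG A T).
Local Notation el := (edge_elt GG A T).
Local Notation M := (graph_monoid A T P).
Implicit Types (g h k p q z : G) (v w u : vertex X) (l : seq (edge X)).

Lemma cone1 v : P v 1. Proof. by have [[]] := P_cone v. Qed.

Lemma coneM v x y : P v x -> P v y -> P v (x * y).
Proof. by have [[_ PvM] _ _] := P_cone v; exact: PvM. Qed.

Lemma cone_total v x : P v x \/ P v x^-1.
Proof.
have [_ PU _] := P_cone v; have : [set: vgroup GG v] x by [].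
by rewrite -PU => -[Px|[y Py <-]]; [left | right; rewrite invgK].
Qed.

Definition pos_le g h := M (g^-1 * h).

Lemma monoid1 : M 1. Proof. by move=> S [[]]. Qed.

Lemma monoidM x y : M x -> M y -> M (x * y).
Proof.
by move=> Mx My S /[dup] SP [[_ SM] _]; apply: SM; [exact: Mx | exact: My].
Qed.

Lemma monoid_vertex v (x : vgroup GG v) : P v x -> M (ov x).
Proof. by move=> Px S [_]; apply; left; exists v => //; exists x. Qed.

Lemma monoid_edge e : M (el e).
Proof.
rewrite /edge_elt; case: pselect => [Ae|_]; last exact: monoid1.
by move=> S [_]; apply; right; exists (exist _ e (mem_set Ae)).
Qed.

Lemma pos_le_refl g : pos_le g g.
Proof. by rewrite /pos_le mulVg; exact: monoid1. Qed.

Lemma pos_le_trans h g k : pos_le g h -> pos_le h k -> pos_le g k.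
Proof.
by move=> gh hk; rewrite /pos_le -(mulVKg h k) mulgA; exact: monoidM.
Qed.

Lemma pos_le_vertex g v (x : vgroup GG v) : P v x -> pos_le g (g * ov x).
Proof. by move=> Px; rewrite /pos_le mulKg; exact: monoid_vertex. Qed.

Lemma pos_le_edge g e : pos_le g (g * el e).
Proof. by rewrite /pos_le mulKg; exact: monoid_edge. Qed.

Fixpoint pos_path l g v h w : Prop :=
  if l is e :: l' then
    (T `|` A) e /\ orig e = v /\
    exists x : vgroup GG (orig e), P (orig e) x /\
      pos_path l' (g * ov x * el e) (targ e) h w
  else exists x : vgroup GG v, [/\ P v x, h = g * ov x & v = w].

Lemma pos_path_vertex g v (x : vgroup GG v) : P v x ->
  pos_path [::] g v (g * ov x) v.
Proof. by exists x. Qed.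

Lemma pos_path_mull l g v (x : vgroup GG v) h w :
  P v x -> pos_path l (g * ov x) v h w -> pos_path l g v h w.
Proof.
move=> Px; case: l => [[y [Py -> vw]]|e l /= [Ee [oe]]].
  subst w; exists (x * y).
  by split; [exact: coneM | rewrite of_vertexM mulgA |].
subst v => -[y [Py ly]]; split=> //; split=> //.
exists (x * y); split; first exact: coneM.
by rewrite of_vertexM mulgA.
Qed.

Lemma pos_path_cat l1 l2 g v k u h w :
  pos_path l1 g v k u -> pos_path l2 k u h w ->
  pos_path (l1 ++ l2) g v h w.
Proof.
elim: l1 g v => [|e l1 IH] g v /=.
  by move=> [x [Px -> vu]]; subst u; exact: pos_path_mull.
move=> [Ee [oe [x [Px l1k]]]] l2h; split=> //; split=> //; exists x; split=> //.
exact: IH l1k l2h.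
Qed.

Lemma pos_path_edge e g : (T `|` A) e ->
  pos_path [:: e] g (orig e) (g * el e) (targ e).
Proof.
move=> Ee; split=> //; split=> //; exists 1; split; first exact: cone1.
by exists 1; rewrite !of_vertex1 !mulg1; split=> //; exact: cone1.
Qed.

Lemma pos_path_tree l g v w :
  edge_path v l w -> (forall e, e \in l -> T e) -> pos_path l g v g w.
Proof.
elim: l v => [|e l IH] v /=.
  by move=> -> _; exists 1; rewrite of_vertex1 mulg1; split=> //; exact: cone1.
move=> [oe lw] lT; have Te : T e by apply: lT; rewrite mem_head.
split; first by left.
split=> //.
exists 1; split; first exact: cone1.
rewrite of_vertex1 edge_elt_tree // !mulg1; apply: IH => // f fl.
by apply: lT; rewrite inE fl orbT.
Qed.

Lemma pos_path_le l g v h w : pos_path l g v h w -> pos_le g h.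
Proof.
elim: l g v => [|e l IH] g v /=.
  by move=> [x [Px -> _]]; exact: pos_le_vertex.
move=> [Ee [_ [x [Px /IH]]]]; apply: pos_le_trans.
by apply: pos_le_trans (pos_le_edge _ e); exact: pos_le_vertex.
Qed.

(** Edges of [T] are trivial in [G] and connect all vertices, so that the
    vertices at both ends of a positive path can be prescribed. *)
Lemma le_pos_path g v h w : pos_le g h -> exists l, pos_path l g v h w.
Proof.
have [T_conn _ _] := T_tree.
suff gen : M `<=` [set y | forall g v w, exists l, pos_path l g v (g * y) w].
  by move=> /gen/(_ g v w); rewrite mulVKg.
have tree g' v' w' : exists l, pos_path l g' v' g' w'.
  have [l [lw lT]] := @T_conn v' w' I I.
  by exists l; exact: pos_path_tree.
apply: smallest_sub; first split.
- by move=> g' v' w'; rewrite mulg1.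
- move=> x y Sx Sy g' v' w'; have [l1 l1P] := Sx g' v' v'.
  have [l2 l2P] := Sy (g' * x) v' w'; exists (l1 ++ l2); rewrite mulgA.
  exact: pos_path_cat l1P l2P.
- move=> _ [[u _ [x Px <-]]|[a _ <-]] g' v' w'.
    have [l1 l1P] := tree g' v' u; have [l2 l2P] := tree (g' * ov x) u w'.
    exists (l1 ++ [::] ++ l2); apply: pos_path_cat l1P _.
    exact: pos_path_cat (pos_path_vertex _ Px) l2P.
  have Aa : A (val a) by exact: set_valP.
  have -> : of_edge GG T a = el (val a).
    rewrite /edge_elt; case: pselect => // {}Aa.
    by congr of_edge; exact/val_inj.
  have [l1 l1P] := tree g' v' (orig (val a)).
  have [l2 l2P] := tree (g' * el (val a)) (targ (val a)) w'.
  exists (l1 ++ [:: val a] ++ l2); apply: pos_path_cat l1P _.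
  by apply: pos_path_cat l2P; apply: pos_path_edge; right.
Qed.

(** [k] is the point from which the path changes sides for the first time. *)
Lemma pos_path_crossing (s : G -> vertex X -> bool)
    (Cr : edge X -> G -> Prop) l g v h w :
  (forall g v (x : vgroup GG v), s (g * ov x) v = s g v) ->
  (forall g f, (T `|` A) f ->
    s (g * el f) (targ f) = s g (orig f) (+) `[< Cr f g >]) ->
  pos_path l g v h w -> s g v != s h w ->
  exists l1 f l2 k, [/\ l = l1 ++ f :: l2, (T `|` A) f /\ Cr f k,
    s k (orig f) = s g v, pos_path l1 g v k (orig f) &
    pos_path l2 (k * el f) (targ f) h w].
Proof.
move=> s_v s_e; elim: l g v => [|f l IH] g v /=.
  by move=> [x [_ -> <-]]; rewrite s_v eqxx.
move=> [Ef [<- [x [Px lP]]]] gh.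
have fx := s_e (g * ov x) f Ef; rewrite s_v in fx.
have [Crf|nCrf] := pselect (Cr f (g * ov x)).
  exists [::], f, l, (g * ov x); split=> //; exact: pos_path_vertex.
rewrite (asboolF nCrf) addbF in fx.
have [|l1 [f' [l2 [k [-> ? ks l1P l2P]]]]] := IH _ _ lP; first by rewrite fx.
exists (f :: l1), f', l2, k; split=> //; first by rewrite ks fx.
by split=> //; split=> //; exists x.
Qed.

(** [s] tells the sides of the edge of the Bass-Serre tree through which [k]
    passes to [k * el e]. A positive path crosses it outwards through [e] at a
    point of [k G_e]; it can only cross it backwards if [inv_edge e] is
    available for positive moves, that is if [e] is in [T]. *)
Record is_half_tree e k (s : G -> vertex X -> bool) : Prop := IsHalfTree {
  half_vertex : forall g v (x : vgroup GG v), s (g * ov x) v = s g v;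
  half_near : s k (orig e) = false;
  half_far : s (k * el e) (targ e) = true;
  half_out : forall l g v h w, pos_path l g v h w ->
    s g v = false -> s h w = true ->
    exists l1 l2 c, let k' := k * ov (emb_orig GG e c) in
      [/\ l = l1 ++ e :: l2, pos_path l1 g v k' (orig e) &
          pos_path l2 (k' * el e) (targ e) h w];
  half_back : forall l g v h w, pos_path l g v h w ->
    s g v = true -> s h w = false ->
    T e /\ exists l1 l2 c, let k' := k * ov (emb_orig GG e c) in
      [/\ l = l1 ++ inv_edge e :: l2, pos_path l1 g v k' (targ e) &
          pos_path l2 k' (orig e) h w]
}.

Lemma half_tree_at e k : (T `|` A) e -> exists s, is_half_tree e k s.
Proof.
move=> Ee; have [s0 [s0_v s0_e s0_1]] := half_tree GG AT0 T_tree no_return Ee.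
pose s g v := s0 (k^-1 * g) v.
have s_v g v (x : vgroup GG v) : s (g * ov x) v = s g v.
  by rewrite /s mulgA s0_v.
have s_e g f : (T `|` A) f ->
    s (g * el f) (targ f) = s g (orig f) (+) `[< crosses e f (k^-1 * g) >].
  by move=> Ef; rewrite /s mulgA s0_e.
have sk : s k (orig e) = false by rewrite /s mulVg.
have coset_k g : edge_coset e (k^-1 * g) ->
    exists c, g = k * ov (emb_orig GG e c).
  by move=> [c _ kc]; exists c; rewrite kc mulVKg.
exists s; split=> //.
- rewrite s_e // sk asboolT //; left; split=> //; rewrite mulVg.
  exact: edge_coset1.
- move=> l g v h w lP gs hs.
  have [|l1 [f [l2 [k' [l_eq [Ef Cr] k's l1P l2P]]]]] :=
    pos_path_crossing s_v s_e lP; first by rewrite gs hs.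
  have f's := s_e k' f Ef; rewrite asboolT // k's gs in f's.
  case: Cr => -[f_eq]; subst f.
    by move=> /coset_k[c k'_eq]; exists l1, l2, c; rewrite /= -k'_eq.
  rewrite -mulgA => /coset_k[c k'_eq]; move: f's.
  by rewrite targ_inv_edge k'_eq s_v sk.
- move=> l g v h w lP gs hs.
  have [|l1 [f [l2 [k' [l_eq [Ef Cr] k's l1P l2P]]]]] :=
    pos_path_crossing s_v s_e lP; first by rewrite gs hs.
  rewrite gs in k's; case: Cr => -[f_eq]; subst f.
    by move=> /coset_k[c k'_eq]; move: k's; rewrite k'_eq s_v sk.
  have Te : T e by case: Ee => // /no_return.
  have Tf : T (inv_edge e) by have [_ T_inv _] := T_tree; exact: T_inv.
  move: l1P l2P; rewrite edge_elt_tree // !mulg1 orig_inv_edge targ_inv_edge.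
  move=> l1P l2P /coset_k[c k'_eq]; split=> //; exists l1, l2, c.
  by rewrite /= -k'_eq.
Qed.

Lemma tree_coset e c : T e -> ov (emb_orig GG e c) = ov (emb_targ GG e c).
Proof.
move=> Te; have := edge_elt_comm AT0 c (or_introl Te : (T `|` A) e).
by rewrite edge_elt_tree // mul1g mulg1.
Qed.

(** The path leaves [k * el e] and returns through the same edge at a point
    [k'] of [k G_e]. As [k <= k'] in the chain at [targ e], the same holds at
    [orig e] by compatibility of the orders on tree edges, and the detour is
    dropped. The hypothesis on shorter paths is [pos_path_closed], which is
    itself proved with this lemma by induction on the length. *)
Lemma half_tree_return e k s l z u :
  is_half_tree e k s ->
  (forall l' (x : vgroup GG (targ e)), size l' < size l ->
     pos_path l' k (targ e) (k * ov x) (targ e) -> P (targ e) x) ->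
  pos_path l (k * el e) (targ e) z u -> s z u = false ->
  exists2 l', size l' < size l & pos_path l' k (orig e) z u.
Proof.
move=> s_half l_pos lP sz.
have [Te [l1 [l2 [c [l_eq l1P l2P]]]]] :=
  half_back s_half lP (half_far s_half) sz.
have l1l : size l1 < size l by rewrite l_eq size_cat /= addnS ltnS leq_addr.
have Pc : P (orig e) (emb_orig GG e c).
  rewrite -[P _ _]/(cone_orig P e c) -P_tree //; apply: (l_pos l1) => //.
  by rewrite -tree_coset //; rewrite edge_elt_tree // mulg1 in l1P.
exists l2; last exact: pos_path_mull l2P.
by rewrite l_eq size_cat /= addnS ltnS leq_addl.
Qed.

(** A closed path in the tree returns through the edge by which it leaves, so
    it can be shortened until it stays in one coset, where injectivity of [G_v
    -> G] applies. *)
Lemma pos_path_closed l g v (x : vgroup GG v) :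
  pos_path l g v (g * ov x) v -> P v x.
Proof.
have [n] := ubnP (size l); elim: n => // n IH in l g v x *; rewrite ltnS => ln.
case: l ln => [_ [y [Py /mulgI/(of_vertex_inj T_tree)-> _]] //|e l ln].
case=> Ee [oe]; subst v => -[y [Py lP]].
have [s s_half] := half_tree_at (g * ov y) Ee.
have [||l' l'l l'P] := half_tree_return s_half _ lP _.
- move=> l1 x1 l1l; apply: IH; exact: leq_trans l1l (ltnW ln).
- by rewrite (half_vertex s_half) -(half_near s_half) (half_vertex s_half).
have l'n : size l' < n by apply: leq_trans l'l _; exact: ltnW.
exact: IH l'n (pos_path_mull Py l'P).
Qed.

Lemma pos_le_vertex_cone g v (x : vgroup GG v) : pos_le g (g * ov x) -> P v x.
Proof. by move=> /(le_pos_path v v)[l]; exact: pos_path_closed. Qed.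

Lemma pos_le_total g v (x : vgroup GG v) :
  pos_le g (g * ov x) \/ pos_le (g * ov x) g.
Proof.
have [Px|Px] := cone_total x; [left|right]; first exact: pos_le_vertex.
by rewrite /pos_le invgM mulgVK -of_vertexV; exact: monoid_vertex.
Qed.

(** * Least upper bounds *)

Variables Apos Aneg : set (edge X).
Hypothesis A_sign : Apos `|` Aneg = A.
Hypothesis P_Apos : forall e, Apos e ->
  emb_targ GG e @` cone_orig P e `<=` P (targ e).
Hypothesis P_Aneg : forall e, Aneg e ->
  emb_targ GG e @` cone_orig P e `<=` invset (P (targ e)).
Hypothesis P_quotient : forall e, (T `|` A) e ->
  forall x : vgroup GG (orig e), P (orig e) x ->
  cone_quotient P e x = set0 \/
  exists2 y : vgroup GG (orig e), P (orig e) y &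
    cone_quotient P e x = lmulset y (cone_orig_image P e).

(** The step of the induction in which the end point of one path moves forward:
    [p1 = h * el e], where [h = p * ov q0] is the least element above [p] of the
    coset of [k = p * ov x] modulo [G_e]. A common upper bound [z] on the far
    side is reached from [p] through this coset, and one on the near side is
    reached from [q] through it, at a point that is above [p] since otherwise
    [q <= p]. *)
Lemma advance e p (x : vgroup GG (orig e)) q w s :
  (T `|` A) e -> P (orig e) x -> is_half_tree e (p * ov x) s ->
  M p -> M q -> s q w = true -> ~ pos_le p q -> ~ pos_le q p ->
  exists p1, [/\ pos_le p p1,
    pos_path [::] p1 (targ e) (p * ov x * el e) (targ e) &
    forall z, pos_le p z -> pos_le q z -> pos_le p1 z].
Proof.
move=> Ee Px s_half Mp Mq sq npq nqp; set k := p * ov x in s_half *.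
have [s_v sk _ out back] := s_half.
have sp : s p (orig e) = false by rewrite -sk s_v.
have pk : pos_le p k by exact: pos_le_vertex.
have [lp lpP] : exists l, pos_path l 1 (orig e) p (orig e).
  by apply: le_pos_path; rewrite /pos_le invg1 mul1g.
have [lq lqP] : exists l, pos_path l 1 (orig e) q w.
  by apply: le_pos_path; rewrite /pos_le invg1 mul1g.
(* The point [k * ov (emb_orig GG e c)] of [k G_e] lies between 1 and [p]. It is
   met on the way back from 1 to [p] if 1 is on the far side, and on the way
   from 1 to [q] otherwise. *)
have [c [y_pos sgn]] : exists c,
    P _ ((emb_orig GG e c)^-1 * x^-1) /\ (T e \/ Apos e).
  case s1 : (s 1 (orig e)).
    have [Te [l1 [l2 [c [_ _ l2P]]]]] := back _ _ _ _ _ lpP s1 sp.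
    exists c; split; last by left.
    apply: (@pos_path_closed l2 (k * ov (emb_orig GG e c))).
    by rewrite of_vertexM !of_vertexV mulgA mulgK /k mulgK.
  have [l1 [l2 [c [_ _ /pos_path_le gq]]]] := out _ _ _ _ _ lqP s1 sq.
  have y_pos : P _ ((emb_orig GG e c)^-1 * x^-1).
    have [//|] := cone_total ((emb_orig GG e c)^-1 * x^-1).
    rewrite invgM !invgK => Pxc; case: npq; apply: pos_le_trans gq.
    apply: pos_le_trans (pos_le_edge _ e); rewrite /k -mulgA -of_vertexM.
    exact: pos_le_vertex.
  exists c; split=> //; case: (Ee) => [|Ae]; first by left.
  (* For [e] in [A_-] the order is reversed: the crossing point [g] of the path
     to [q] is below [k], so [p <= k <= k e <= g e <= q]. *)
  right; move: (Ae); rewrite -{1}A_sign => -[//|/P_Aneg neg]; case: npq.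
  have : invset (P (targ e)) (emb_targ GG e c^-1).
    apply: neg; exists c^-1 => //; rewrite /cone_orig /= morph_inv.
    by have := coneM y_pos Px; rewrite mulgVK.
  move=> [d Pd]; rewrite morph_inv => /invg_inj dc; rewrite {}dc in Pd.
  apply: pos_le_trans gq; apply: (pos_le_trans pk).
  apply: (pos_le_trans (pos_le_edge _ e)).
  rewrite -(mulgA k (ov _)) edge_elt_comm // (mulgA k); exact: pos_le_vertex.
set y := _ * _ in y_pos.
have mono d : P _ (emb_orig GG e d) -> P _ (emb_targ GG e d).
  case: sgn => [Te Pd|Ap Pd]; last by apply: (P_Apos Ap); exists d.
  by rewrite -[P _ _]/(cone_targ P e d) P_tree.
have y_quot (d : egroup GG e) : pos_le p (k * ov (emb_orig GG e d)) ->
    cone_quotient P e y (x * emb_orig GG e d).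
  rewrite /k -mulgA -of_vertexM => /pos_le_vertex_cone Pxd; split=> //.
  exists (c^-1 * d); rewrite /cone_orig /= ?gmulfM morph_inv.
    by have := coneM y_pos Pxd; rewrite /y mulgA mulgVK.
  by rewrite /y mulgA mulgVK.
have k_quot : cone_quotient P e y x.
  by rewrite -[x]mulg1 -(morph_one (emb_orig GG e)); apply: y_quot;
    rewrite morph_one of_vertex1 mulg1.
have [quot0|[q0 Pq0 quot_eq]] := P_quotient Ee y_pos.
  by rewrite quot0 in k_quot.
pose p1 := p * ov q0 * el e.
(* Every point of [k G_e] above [p] passes beyond [p1] when it crosses [e]. *)
have p1_min d : pos_le p (k * ov (emb_orig GG e d)) -> exists2 d',
    P _ (emb_targ GG e d') & k * ov (emb_orig GG e d) * el e =
    p1 * ov (emb_targ GG e d').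
  move=> /y_quot; rewrite quot_eq => -[_ [d' Pd' <-]] xd.
  exists d'; first exact: mono.
  rewrite /k -(mulgA p) -of_vertexM -xd of_vertexM /p1 -!mulgA.
  by rewrite edge_elt_comm.
exists p1; split.
- by apply: pos_le_trans (pos_le_edge _ e); exact: pos_le_vertex.
- have [|d Pd] := p1_min 1; rewrite morph_one of_vertex1 mulg1 // => ->.
  exact: pos_path_vertex.
move=> z pz qz.
have [lz lzP] := le_pos_path (orig e) (orig e) pz.
have [lz' lzP'] := le_pos_path w (orig e) qz.
case sz : (s z (orig e)).
  have [l1 [l2 [d [_ /pos_path_le pd /pos_path_le dz]]]] :=
    out _ _ _ _ _ lzP sp sz.
  apply: pos_le_trans dz; have [d' Pd' ->] := p1_min d pd; exact: pos_le_vertex.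
have [Te [l1 [l2 [d [_ /pos_path_le qd /pos_path_le dz]]]]] :=
  back _ _ _ _ _ lzP' sq sz.
have k_eq : k * ov (emb_orig GG e d) = p * ov (x * emb_orig GG e d).
  by rewrite of_vertexM mulgA.
have [pd|dp] := pos_le_total p (x * emb_orig GG e d); last first.
  by case: nqp; apply: pos_le_trans qd _; rewrite k_eq.
rewrite -k_eq in pd; apply: pos_le_trans dz.
have [d' Pd'] := p1_min d pd; rewrite edge_elt_tree // mulg1 => ->.
exact: pos_le_vertex.
Qed.

Definition has_lub p q : Prop :=
  exists r, [/\ pos_le p r, pos_le q r &
    forall z, pos_le p z -> pos_le q z -> pos_le r z].

Lemma has_lub_sym p q : has_lub p q -> has_lub q p.
Proof.
by move=> [r [pr qr r_min]]; exists r; split=> // z qz pz; exact: r_min.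
Qed.

Lemma pos_le_has_lub p q : pos_le p q -> has_lub p q.
Proof. by move=> pq; exists q; split=> //; exact: pos_le_refl. Qed.

(** Induction on the total length of the two paths. The position of [z] and [q]
    with respect to the first edge of a nonempty path tells whether a path can
    be shortened, [z] replaced by a smaller bound, or [p] moved by [advance];
    if both paths are empty, [p] and [q] lie in the same chain. *)
Lemma bounded_has_lub l1 l2 p v q w z u : M p -> M q ->
  pos_path l1 p v z u -> pos_path l2 q w z u -> has_lub p q.
Proof.
have [n] := ubnP (size l1 + size l2).
elim: n => // n IH in l1 l2 p v q w z u *; rewrite ltnS => ln Mp Mq.
have step e l (l' : seq (edge X)) p' v' q' w' : size l + size l' < n ->
    M p' -> M q' -> pos_path (e :: l) p' v' z u ->
    pos_path l' q' w' z u -> has_lub p' q'.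
  move=> {Mp Mq p v q w l1 l2}ln Mp Mq [Ee [oe]] + l2P.
  move: p' Mp q' w' Mq l2P.
  subst v' => p Mp q w Mq l2P [x [Px lP]].
  have [pq|npq] := pselect (pos_le p q); first exact: pos_le_has_lub.
  have [qp|nqp] := pselect (pos_le q p); first exact/has_lub_sym/pos_le_has_lub.
  have [s s_half] := half_tree_at (p * ov x) Ee.
  case sz : (s z u); last first.
    have [l0 y _|l0 l0l l0P] := half_tree_return s_half _ lP sz.
      exact: pos_path_closed.
    apply: (IH l0 l' _ _ _ _ _ _ _ Mp Mq (pos_path_mull Px l0P) l2P).
    by apply: leq_trans ln; rewrite ltnS leq_add2r ltnW.
  case sq : (s q w); last first.
    have [l1 [l2 [c [l'_eq qk _]]]] := half_out s_half l2P sq sz.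
    have l1n : size l1 < n.
      apply: leq_trans ln; rewrite l'_eq size_cat /= !addnS ltnS.
      by rewrite ltnW // ltnS addnCA leq_addr.
    (* [k] and the crossing point of the path from [q] are comparable; the
       larger one is a common upper bound that is reached sooner. *)
    have [Pc|Pc] := cone_total (emb_orig GG e c).
      apply: (IH [::] l1 _ _ _ _ _ _ _ Mp Mq _ qk) => //.
      by apply: (pos_path_mull Px); exact: pos_path_vertex.
    apply: (IH [::] (l1 ++ [::]) _ _ _ _ _ _ _ Mp Mq (pos_path_vertex p Px)).
      by rewrite cats0.
    apply: pos_path_cat qk _; exists (emb_orig GG e c)^-1.
    by rewrite of_vertexV mulgK.
  have [p1 [pp1 p1k p1_min]] :=
    advance Ee Px s_half Mp Mq sq npq nqp.
  have Mp1 : M p1 by rewrite -(mulVKg p p1); exact: monoidM.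
  have [|r [p1r qr r_min]] :=
    IH _ _ _ _ _ _ _ _ _ Mp1 Mq (pos_path_cat p1k lP) l2P; first exact: ln.
  exists r; split=> // [|z' pz' qz']; first exact: pos_le_trans pp1 p1r.
  by apply: r_min => //; exact: p1_min.
case: l1 ln => [|e l] ln; last by move=> l1P l2P; exact: step ln _ _ l1P l2P.
case: l2 ln => [|e l] ln l1P l2P; last first.
  by apply: has_lub_sym; apply: (step e l [::] q w p v) => //; rewrite addn0.
move: l1P l2P => [x [_ z_eq vu]] [y [_ z_eq' wu]]; subst v w.
have q_eq : q = p * ov (x * y^-1).
  by rewrite of_vertexM of_vertexV mulgA -z_eq z_eq' mulgK.
have [pq|qp] := pos_le_total p (x * y^-1).
  by apply: pos_le_has_lub; rewrite q_eq.
by apply: has_lub_sym; apply: pos_le_has_lub; rewrite q_eq.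
Qed.

Lemma graph_monoid_right_LCM : vertex X -> right_LCM M.
Proof.
move=> v p q Mp Mq.
have leE g z : lmulset g M z <-> pos_le g z.
  split=> [[x Mx <-]|gz]; first by rewrite /pos_le mulKg.
  by exists (g^-1 * z); rewrite ?mulVKg.
have [->|/set0P[z [/leE pz /leE qz]]] :=
  eqVneq (lmulset p M `&` lmulset q M) set0; first by left.
have [l1 l1P] := le_pos_path v v pz.
have [l2 l2P] := le_pos_path v v qz.
have [r [pr qr r_min]] := bounded_has_lub Mp Mq l1P l2P.
right; exists r; first by rewrite -(mulVKg p r); exact: monoidM.
apply/seteqP; split=> y.
  by move=> [/leE py /leE qy]; apply/leE; exact: r_min.
move=> /leE ry; split; apply/leE.
  exact: pos_le_trans pr ry.
exact: pos_le_trans qr ry.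
Qed.

End PositivePaths.

Lemma maximal_subtree_edges_spanning (X : serre_graph) (T : set (edge X)) :
  connected_graph X -> maximal_subtree_edges T ->
  [/\ connected_subgraph setT T,
      forall e, T e -> T (inv_edge e) & forall p, ~ circuit T p].
Proof.
move=> X_conn [W WT]; have [[[T_inv _] _ W_conn T_free] _] := WT.
split=> // v w _ _; apply: W_conn;
  exact: (maximal_subtree_spans _ X_conn WT).
Qed.

Unset Implicit Arguments.

Theorem proposition3p2 (X : serre_graph) (GG : graph_of_groups X)
  (A T Apos Aneg : set (edge X)) (P : forall v, set (vgroup GG v))
  (X_connected : connected_graph X)
  (T_maximal : maximal_subtree_edges T)
  (E_decomposition : edge_decomposition A T)
  (P_cone : forall v, positive_cone (P v))
  (P_tree : forall e, T e -> cone_targ P e = cone_orig P e)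
  (A_union : Apos `|` Aneg = A) (A_disjoint : Apos `&` Aneg = set0)
  (P_Apos : forall e, Apos e ->
     emb_targ GG e @` cone_orig P e `<=` P (targ e))
  (P_Aneg : forall e, Aneg e ->
     emb_targ GG e @` cone_orig P e `<=` invset (P (targ e)))
  (P_quotient : forall e, (T `|` A) e -> forall p, P (orig e) p ->
     cone_quotient P e p = set0 \/
     exists2 q, P (orig e) q &
       cone_quotient P e p = lmulset q (cone_orig_image P e)) :
  right_LCM (graph_monoid A T P).
Proof.
have [_ AAbar AT AbarT] := E_decomposition.
have [v _] : exists v : vertex X, True.
  by have [W [[_ [v _] _ _] _]] := T_maximal; exists v.
have no_return e : A e -> ~ (T `|` A) (inv_edge e).
  move=> Ae; have Abar : [set inv_edge e | e in A] (inv_edge e) by exists e.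
  by case=> Ee; [rewrite -[False]/(set0 (inv_edge e)) -AbarT
               | rewrite -[False]/(set0 (inv_edge e)) -AAbar].
apply: graph_monoid_right_LCM v => //.
- exact: maximal_subtree_edges_spanning.
- exact: A_union.
- exact: P_Apos.
- exact: P_Aneg.
Qed.
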